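(* Let $n\in\mathbb{N}$, $n\geq 1$, let $s,t\in\mathbb{R}$ with $s\cdot t\neq 0$, and let $\mathbf{D}=\operatorname{diag}(v_1,\ldots,v_n)$ with $v_1,\ldots,v_n\in\mathbb{C}$ and $\prod_{i=1}^n v_i\neq 0$. Then $$\|\mathbf{D}\|_{s,t} = \|\mathbf{D}\|_{-t,-s}.$$
   Context: Hölder weights on $\mathbb{C}^n$: for $\vec{x}=(x_1,\ldots,x_n)\in\mathbb{C}^n$, - for $p\in(0,\infty)$: $\|\vec{x}\|_p := \left(\sum_{i=1}^n |x_i|^p\right)^{1/p}$; - for $p\in(-\infty,0)$: $\|\vec{x}\|_p := \left(\sum_{i=1}^n |x_i|^p\right)^{1/p}$ if $\prod_{i=1}^n x_i\neq 0$, and $\|\vec{x}\|_p := 0$ if $\prod_{i=1}^n x_i=0$. For $s,t\in\mathbb{R}\setminus\{0\}$, $\|\mathbf{D}\|_{s,t}$ denotes the operator weight of the linear map $\mathbf{D}:(\mathbb{C}^n,\|\cdot\|_s)\to(\mathbb{C}^n,\|\cdot\|_t)$, that is, $\|\mathbf{D}\|_{s,t} := \inf\{C>0 \mid \forall \vec{x}\in\mathbb{C}^n:\ \|\mathbf{D}\vec{x}\|_t\le C\|\vec{x}\|_s\}\in[0,\infty]$, with $\inf\emptyset=\infty$. *)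

(* Defs.v *)
From mathcomp Require Export all_boot all_order all_algebra.
From mathcomp Require Export complex.
From mathcomp Require Export all_classical all_reals all_analysis.

Set Implicit Arguments.
Unset Strict Implicit.
Unset Printing Implicit Defensive.

Import Order.TTheory GRing.Theory Num.Theory.

Local Open Scope classical_set_scope.
Local Open Scope ring_scope.

(* The norm `|z| of z : R[i] lies in R[i]; Normc.normc is the R-valued modulus.
   The value at p = 0 is junk. *)
Definition holder_weight (R : realType) (n : nat) (p : R) (x : 'cV[R[i]]_n) : R :=
  if (p < 0) && (\prod_(i < n) x i 0 == 0) then 0
  else (\sum_(i < n) Normc.normc (x i 0) `^ p) `^ p^-1.

(* ereal_inf set0 = +oo, so the weight is +oo when no constant C works. *)
Definition operator_weight (R : realType) (m n : nat) (s t : R)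
    (A : 'M[R[i]]_(m, n)) : \bar R :=
  ereal_inf [set C%:E | C in [set C : R | 0 < C /\
    forall x : 'cV[R[i]]_n,
      holder_weight t (A *m x) <= C * holder_weight s x]].

(* Main.v *)
(** For a vector [x] without zero entries, the weights of [x] and of its
    entrywise inverse satisfy [|1/x|_(-p) = 1 / |x|_p]. Hence the substitution
    [x := 1/(v y)] turns the inequality [|v x|_t <= C |x|_s] into
    [|v y|_(-s) <= C |y|_(-t)]. Zero entries do not matter: if [t < 0] the left
    side vanishes, and if [t > 0] they can be replaced by small positive numbers,
    which increases [|v x|_t] and raises [|x|_s] by an arbitrarily small amount. *)

Require Import Defs.
From mathcomp Require Import all_boot all_order all_algebra.
From mathcomp Require Import complex.
From mathcomp Require Import all_classical all_reals all_analysis.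

Import Order.TTheory GRing.Theory Num.Theory.
Local Open Scope ring_scope.

Lemma normc_ge0 {R : rcfType} (z : R[i]) : 0 <= Normc.normc z.
Proof. by case: z => a b; exact: sqrtr_ge0. Qed.

Lemma normc_gt0 {R : rcfType} (z : R[i]) : z != 0 -> 0 < Normc.normc z.
Proof.
move=> z0; rewrite lt_def normc_ge0 andbT.
by apply: contraNneq z0 => /Normc.eq0_normc ->.
Qed.

Lemma normc_real {R : rcfType} (a : R) : 0 <= a -> Normc.normc (a%:C)%C = a.
Proof. by move=> a0; rewrite /= expr0n /= addr0 sqrtr_sqr ger0_norm. Qed.

Lemma powRV {R : realType} (a p : R) : 0 <= a -> a^-1 `^ p = (a `^ p)^-1.
Proof. by move=> a0; rewrite -!powR_inv1 ?powR_ge0// powRAC. Qed.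

Lemma powRK {R : realType} (a p : R) : 0 <= a -> p != 0 -> (a `^ p) `^ p^-1 = a.
Proof. by move=> a0 p0; rewrite -powRrM divff// powRr1. Qed.

Lemma powRKV {R : realType} (a p : R) : 0 <= a -> p != 0 -> (a `^ p^-1) `^ p = a.
Proof. by move=> a0 p0; rewrite -powRrM mulVf// powRr1. Qed.

Section HolderWeight.
Context {R : realType} {n : nat}.
Implicit Types (x y : 'cV[R[i]]_n) (p : R).

Definition nonvanishing x := forall i, x i 0 != 0.

Lemma nonvanishing_prod x : \prod_i x i 0 != 0 <-> nonvanishing x.
Proof.
split=> [/prodf_neq0 x0 i|x0]; first exact: x0.
by apply/prodf_neq0 => i _.
Qed.

Lemma holder_weight_nonvanishing {p x} : nonvanishing x ->
  holder_weight p x = (\sum_i Normc.normc (x i 0) `^ p) `^ p^-1.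
Proof. by move=> /nonvanishing_prod/negPf x0; rewrite /holder_weight x0 andbF. Qed.

Lemma holder_weight_pos {p x} : 0 < p ->
  holder_weight p x = (\sum_i Normc.normc (x i 0) `^ p) `^ p^-1.
Proof. by move=> p0; rewrite /holder_weight ltNge ltW. Qed.

Lemma holder_weight_ge0 p x : 0 <= holder_weight p x.
Proof. by rewrite /holder_weight; case: ifP => // _; exact: powR_ge0. Qed.

(** The sign of the inner exponent cancels against the inversion of the entries, so both sums agree;
    the sign of the outer exponent produces the inverse. *)
Lemma holder_weight_inv p x : nonvanishing x ->
  holder_weight (- p) (map_mx GRing.inv x) = (holder_weight p x)^-1.
Proof.
move=> x0; have y0 : nonvanishing (map_mx GRing.inv x).
  by move=> i; rewrite mxE invr_eq0.
rewrite (holder_weight_nonvanishing y0) (holder_weight_nonvanishing x0).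
rewrite invrN powRN; congr (_ `^ _)^-1.
apply: eq_bigr => i _.
by rewrite mxE Normc.normcV powRN powRV ?normc_ge0// invrK.
Qed.

Lemma holder_weight_le p x y : 0 < p ->
  (forall i, Normc.normc (x i 0) <= Normc.normc (y i 0)) ->
  holder_weight p x <= holder_weight p y.
Proof.
move=> p0 xy; rewrite !(holder_weight_pos p0).
apply: ge0_ler_powR; rewrite ?nnegrE ?invr_ge0 ?(ltW p0) ?sumr_ge0//.
- by move=> i _; exact: powR_ge0.
- by move=> i _; exact: powR_ge0.
apply: ler_sum => i _.
by apply: ge0_ler_powR; rewrite ?nnegrE ?normc_ge0// ltW.
Qed.

(** The index [i] rules out the empty sum. *)
Lemma holder_weight_gt0 p x (i : 'I_n) : nonvanishing x -> 0 < holder_weight p x.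
Proof.
move=> x0; rewrite (holder_weight_nonvanishing x0); apply: powR_gt0.
rewrite (bigD1 i)//= ltr_pwDl ?powR_gt0 ?normc_gt0//.
by apply: sumr_ge0 => j _; exact: powR_ge0.
Qed.

Lemma holder_weight_pos_ge_entry p x i : 0 < p ->
  Normc.normc (x i 0) <= holder_weight p x.
Proof.
move=> p0; rewrite (holder_weight_pos p0).
rewrite -{1}(powRK _ p (normc_ge0 (x i 0))) ?gt_eqF//.
apply: ge0_ler_powR; rewrite ?nnegrE ?invr_ge0 ?(ltW p0) ?powR_ge0 ?sumr_ge0//.
  by move=> j _; exact: powR_ge0.
by rewrite (bigD1 i)//= lerDl sumr_ge0// => j _; exact: powR_ge0.
Qed.

(** Entrywise inversion reduces this to the lower bound for the positive exponent [- p]. *)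
Lemma holder_weight_neg_le_entry p x i : p < 0 -> nonvanishing x ->
  holder_weight p x <= Normc.normc (x i 0).
Proof.
move=> p0 x0.
rewrite -lef_pV2 ?posrE ?holder_weight_gt0 ?normc_gt0//.
rewrite -holder_weight_inv// -Normc.normcV.
have -> : (x i 0)^-1 = map_mx GRing.inv x i 0 by rewrite mxE.
by apply: holder_weight_pos_ge_entry; rewrite oppr_gt0.
Qed.

Definition fill_zeros (e : R) x : 'cV[R[i]]_n :=
  \col_i (if x i 0 == 0 then e%:C%C else x i 0).

Lemma fill_zeros_nonvanishing e x : 0 < e -> nonvanishing (fill_zeros e x).
Proof.
move=> e0 i; rewrite mxE; case: ifPn => // _.
by apply/eqP => /(congr1 (@Normc.normc R))/eqP;
  rewrite Normc.normc0 normc_real ?(ltW e0)// gt_eqF.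
Qed.

Lemma normc_fill_zeros_ge e x i :
  Normc.normc (x i 0) <= Normc.normc (fill_zeros e x i 0).
Proof.
by rewrite mxE; case: eqP => [->|//]; rewrite Normc.normc0 normc_ge0.
Qed.

(** Used to move a strict violation of a bound from [x] to a vector without zeros: the strict
    inequality leaves room to fill the zeros. *)
Lemma holder_weight_approx p x (c : R) : p != 0 -> holder_weight p x < c ->
  exists y, [/\ nonvanishing y,
    forall i, Normc.normc (x i 0) <= Normc.normc (y i 0) &
    holder_weight p y < c].
Proof.
move=> p0 xc; have c0 : 0 < c := le_lt_trans (holder_weight_ge0 p x) xc.
have [pneg|ppos] : p < 0 \/ 0 < p by case: ltgtP p0; [left|right|].
- have [[i /eqP xi0]|xn0] := pselect (exists i, x i 0 == 0); last first.
    exists x; split=> // i; apply/negP => xi0; apply: xn0.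
    by exists i.
  (* For [p < 0] a single small entry forces the whole weight to be small, so filling the zeros, of
     which there is at least one, with [c / 2] suffices. *)
  have e0 : 0 < c / 2 by rewrite divr_gt0.
  have y0 := fill_zeros_nonvanishing (c / 2) x e0.
  exists (fill_zeros (c / 2) x); split; [exact: y0|exact: normc_fill_zeros_ge|].
  apply: le_lt_trans (holder_weight_neg_le_entry p _ i pneg y0) _.
  rewrite mxE xi0 eqxx normc_real ?(ltW e0)//.
  by rewrite ltr_pdivrMr// ltr_pMr// ltr1n.
- set S := \sum_i Normc.normc (x i 0) `^ p.
  have S0 : 0 <= S by apply: sumr_ge0 => i _; exact: powR_ge0.
  have Sc : S < c `^ p.
    rewrite -(powRKV S p)//; apply: gt0_ltr_powR; rewrite ?nnegrE ?powR_ge0 ?(ltW c0)//.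
    by rewrite -holder_weight_pos.
  (* Each filled zero adds [d] to the sum of [p]-th powers, and there are at most [n] of them.
     Dividing the gap by [n.+1] keeps the total increase strictly below it, even when [n = 0]. *)
  pose d := (c `^ p - S) / n.+1%:R.
  have d0 : 0 < d by rewrite divr_gt0 ?subr_gt0.
  have e0 : 0 < d `^ p^-1 by exact: powR_gt0.
  exists (fill_zeros (d `^ p^-1) x); split=> [|i|].
  + exact: fill_zeros_nonvanishing.
  + exact: normc_fill_zeros_ge.
  rewrite (holder_weight_pos ppos) -(powRK c p) ?(ltW c0)//.
  apply: gt0_ltr_powR; rewrite ?nnegrE ?invr_gt0 ?powR_ge0//.
    by apply: sumr_ge0 => i _; exact: powR_ge0.
  apply: (@le_lt_trans _ _ (S + n%:R * d)).
    have -> : n%:R * d = \sum_(i < n) d by rewrite sumr_const card_ord mulr_natl.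
    rewrite -big_split/=.
    apply: ler_sum => i _; rewrite mxE; case: eqP => [->|_].
      by rewrite Normc.normc0 powR0// add0r normc_real ?(ltW e0)// powRKV ?(ltW d0).
    by rewrite lerDl ltW.
  rewrite addrC -ltrBrDr mulrC mulrAC ltr_pdivrMr// ltr_pM2l ?subr_gt0//.
  by rewrite ltr_nat.
Qed.

End HolderWeight.

Section DiagonalBound.
Context {R : realType} {n : nat} (v : 'rV[R[i]]_n).
Hypothesis v_neq0 : forall i, v 0 i != 0.
Implicit Types (x : 'cV[R[i]]_n) (s t C : R).

Lemma diag_mulE x i : (diag_mx v *m x) i 0 = v 0 i * x i 0.
Proof. by rewrite mul_diag_mx mxE. Qed.

Lemma diag_mul_nonvanishing x : nonvanishing x -> nonvanishing (diag_mx v *m x).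
Proof. by move=> x0 i; rewrite diag_mulE mulf_neq0. Qed.

Lemma diag_bound_nonvanishing s t C : s != 0 -> t != 0 -> 0 < C ->
  (forall x, nonvanishing x ->
    holder_weight t (diag_mx v *m x) <= C * holder_weight s x) ->
  forall x, holder_weight t (diag_mx v *m x) <= C * holder_weight s x.
Proof.
move=> s0 t0 C0 bound x.
have [tneg|tpos] : t < 0 \/ 0 < t by case: ltgtP t0; [left|right|].
- have [/eqP Dx0|/nonvanishing_prod Dx0] := boolP (\prod_i (diag_mx v *m x) i 0 == 0).
    rewrite {1}/holder_weight tneg Dx0 eqxx/=.
    by rewrite mulr_ge0 ?holder_weight_ge0 ?ltW.
  apply: bound => i; have := Dx0 i.
  by rewrite diag_mulE mulf_eq0 negb_or => /andP[].
(* If the bound failed at [x], then [x] would have [s]-weight below the [t]-weight of its image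
   divided by [C]. Some nonvanishing [y] stays below this threshold and dominates [x] entrywise;
   since [t > 0], its image weighs at least as much, so the bound fails at [y] too. *)
- rewrite leNgt; apply/negP.
  rewrite mulrC -ltr_pdivlMr// => /(holder_weight_approx _ _ _ s0)[y [y0 xy]].
  rewrite ltr_pdivlMr// mulrC; apply/negP; rewrite -leNgt.
  apply: le_trans (bound y y0); apply: holder_weight_le => // i.
  by rewrite !diag_mulE !Normc.normcM ler_wpM2l ?normc_ge0.
Qed.

Lemma diag_bound_dual s t C : (0 < n)%N -> s != 0 -> t != 0 -> 0 < C ->
  (forall x, holder_weight t (diag_mx v *m x) <= C * holder_weight s x) ->
  forall x, holder_weight (- s) (diag_mx v *m x) <= C * holder_weight (- t) x.
Proof.
move=> n0 s0 t0 C0 bound; apply: diag_bound_nonvanishing; rewrite ?oppr_eq0//.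
move=> x x0; have Dx0 := diag_mul_nonvanishing _ x0.
pose y : 'cV[R[i]]_n := map_mx GRing.inv (diag_mx v *m x).
have y0 : nonvanishing y by move=> i; rewrite mxE invr_eq0.
have Dy : diag_mx v *m y = map_mx GRing.inv x.
  apply/colP => i; rewrite diag_mulE mxE diag_mulE mxE.
  by rewrite invfM mulrA divff ?mul1r.
have Nt := holder_weight_inv (- t) _ x0; rewrite opprK in Nt.
have Ns := holder_weight_inv (- s) _ Dx0; rewrite opprK in Ns.
(* The bound at [y] compares reciprocals of the two weights wanted; their positivity permits
   cross-multiplication. *)
have Nt0 := holder_weight_gt0 (- t) _ (Ordinal n0) x0.
have Ns0 := holder_weight_gt0 (- s) _ (Ordinal n0) Dx0.
have := bound y; rewrite Dy Nt Ns (ler_pdivlMr _ _ Ns0) mulrC.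
by rewrite (ler_pdivrMr _ _ Nt0).
Qed.

End DiagonalBound.

Theorem corollary1 (R : realType) (n : nat) (hn : (1 <= n)%N) (s t : R)
    (hst : s * t != 0) (v : 'rV[R[i]]_n) (hv : \prod_(i < n) v 0 i != 0) :
  operator_weight s t (diag_mx v) = operator_weight (- t) (- s) (diag_mx v).
Proof.
have v0 i : v 0 i != 0 by move/prodf_neq0: hv; apply.
move: hst; rewrite mulf_eq0 negb_or => /andP[s0 t0].
have dual := diag_bound_dual v v0 _ _ _ hn.
(* The sets of admissible constants themselves coincide, which also covers the infinite case. *)
rewrite /operator_weight; apply: (congr1 (fun A => ereal_inf (image A EFin))).
apply/seteqP; split=> C [C0 bound].
- exact: conj C0 (dual _ _ _ s0 t0 C0 bound).
(* The map from [(s, t)] to [(- t, - s)] is an involution, so the same implication gives the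
   converse. *)
- have ns0 : - s != 0 by rewrite oppr_eq0.
  have nt0 : - t != 0 by rewrite oppr_eq0.
  have := dual _ _ _ nt0 ns0 C0 bound; rewrite !opprK => bound'.
  exact: conj C0 bound'.
Qed.
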